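(* Let $K=(\mathcal V,\mathcal E)$ be a connected, locally finite graph with weights $c$ on vertices and $r$ on edges. Suppose that $K$ is $\chi$-complete (so that $D=d+\delta$ defined on $C_0^0(K)\oplus C_0^1(K)$ is essentially self-adjoint). Then for every $i\in C_0^0(K)$ satisfying $\sum_{v\in\mathcal V}c(v)i(v)=0$ and every $E'\in L_2(\mathcal E)$ there exists a unique solution of minimal energy $I\in\operatorname{Dom}(\bar\delta)$ of the problem $$\bar\delta(I)+i=0\quad\text{and}\quad \int_Z E'=\int_Z I\ \text{ for every }L_2\text{-cycle }Z.$$ Here a solution of minimal energy is a solution whose $L_2(\mathcal E)$-norm is minimal among all solutions in $\operatorname{Dom}(\bar\delta)$.
   Context: A graph $K=(\mathcal V,\mathcal E)$ consists of a set $\mathcal V$ of vertices and a set $\mathcal E\subset\mathcal V\times\mathcal V$ of oriented edges, which is symmetric ($(v_1,v_2)\in\mathcal E\Rightarrow(v_2,v_1)\in\mathcal E$) and without loops. For $e=(v_1,v_2)\in\mathcal E$ put $e^-=v_1$, $e^+=v_2$, $-e=(v_2,v_1)$. $K$ is connected if any two vertices are joined by a finite path of edges, and locally finite if each vertex belongs to finitely many edges. Weights: $c:\mathcal V\to(0,\infty)$ and $r:\mathcal E\to(0,\infty)$ with $r(-e)=r(e)$. $C^0(K)=\mathbb C^{\mathcal V}$; $C^1(K)=\{\varphi:\mathcal E\to\mathbb C:\ \varphi(-e)=-\varphi(e)\}$; $C_0^0(K)$, $C_0^1(K)$ are the subspaces of finitely supported elements. Inner products: $\langle f,g\rangle=\sum_{v\in\mathcal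 V}c(v)f(v)\overline{g(v)}$ and $\langle\varphi,\psi\rangle=\frac12\sum_{e\in\mathcal E}r(e)\varphi(e)\overline{\psi(e)}$; $L_2(\mathcal V)$, $L_2(\mathcal E)$ are the Hilbert spaces of elements of $C^0(K)$, $C^1(K)$ of finite norm. Operators: $d f(e)=f(e^+)-f(e^-)$ on $C_0^0(K)$ and $\delta\varphi(x)=\frac{1}{c(x)}\sum_{e\in\mathcal E,\,e^+=x}r(e)\varphi(e)$ on $C_0^1(K)$; $D(f,\varphi)=(\delta\varphi,df)$. $\bar\delta$ is the closure of $\delta$ as an operator from $L_2(\mathcal E)$ to $L_2(\mathcal V)$ with initial domain $C_0^1(K)$. Cycles: a (possibly infinite) 1-chain is a formal sum $Z=\frac12\sum_{e\in\mathcal E}z_e e$ with $z_e\in\mathbb Z$, $z_{-e}=-z_e$; its boundary is $\partial Z=\sum_{x\in\mathcal V}\big(\sum_{e^+=x}z_e\big)x$, and $Z$ is a cycle if $\partial Z=0$. To $Z$ one associates the 1-cochain $E_Z(e)=z_e/r(e)$; $Z$ is an $L_2$-cycle if it is a cycle with $E_Z\in L_2(\mathcal E)$. For $E\in L_2(\mathcal E)$, $\int_Z E=\frac12\sum_{e\in\mathcal E}z_eE(e)=\langle E,E_Z\rangle$. $K$ is $\chi$-complete if there is an increasing sequence of finite sets $(B_n)_{n\in\mathbb N}$ with $\mathcal V=\bigcup_n B_n$ and functions $\chi_n$ such that: (i) $\chi_n\in C_0^0(K)$, $0\le\chi_n\le1$; (ii) $v\in B_n\Rightarrow\chi_n(v)=1$;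 (iii) there is $C>0$ such that for all $n\in\mathbb N$ and $x\in\mathcal V$, $\frac{1}{c(x)}\sum_{e:\ e^+=x\text{ or }e^-=x}r(e)\,(d\chi_n(e))^2\le C$. *)

(* Defs.v *)
From HB Require Import structures.
From mathcomp Require Import all_boot all_order all_algebra.
From mathcomp Require Import all_classical all_reals all_analysis.
From mathcomp Require Import complex.
Set Implicit Arguments.
Unset Strict Implicit.
Unset Printing Implicit Defensive.
Import Order.TTheory GRing.Theory Num.Theory.
Import numFieldNormedType.Exports.

Local Open Scope classical_set_scope.
Local Open Scope ring_scope.
Local Open Scope complex_scope.

Record graph := Graph {
  vertex : choiceType;
  adj : rel vertex;
  adj_sym : symmetric adj;
  adj_irr : irreflexive adj }.

(* Oriented edges: every adjacent pair contributes both of its orientations. *)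
Definition edge (K : graph) := {e : vertex K * vertex K | adj e.1 e.2}.
HB.instance Definition _ (K : graph) := Choice.on (edge K).

Definition edge_tail (K : graph) (e : edge K) : vertex K := (val e).1.
Definition edge_head (K : graph) (e : edge K) : vertex K := (val e).2.

Lemma opp_edge_subproof (K : graph) (e : edge K) : adj (edge_head e) (edge_tail e).
Proof. by rewrite adj_sym; exact: (valP e). Qed.

Definition opp_edge (K : graph) (e : edge K) : edge K :=
  exist _ (edge_head e, edge_tail e) (opp_edge_subproof e).

Definition connected_graph (K : graph) : Prop :=
  forall x y : vertex K, exists2 p, path (@adj K) x p & last x p = y.

Definition locally_finite (K : graph) : Prop :=
  forall x : vertex K, finite_set [set e : edge K | edge_head e = x \/ edge_tail e = x].

Record weighted_graph (R : realType) := WeightedGraph {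
  wgraph :> graph;
  vweight : vertex wgraph -> R;
  eweight : edge wgraph -> R;
  vweight_gt0 : forall v, 0 < vweight v;
  eweight_gt0 : forall e, 0 < eweight e;
  eweight_opp : forall e, eweight (opp_edge e) = eweight e }.

Definition fin_supp (T : choiceType) (M : zmodType) (f : T -> M) : Prop :=
  finite_set [set t | f t != 0].

Definition antisymmetric1 (K : graph) (M : zmodType) (phi : edge K -> M) : Prop :=
  forall e, phi (opp_edge e) = - phi e.

Definition coboundary (K : graph) (M : zmodType) (f : vertex K -> M)
  (e : edge K) : M := f (edge_head e) - f (edge_tail e).

(* Sum of an absolutely summable complex family, with real and imaginary parts
   split into positive and negative parts.  On a family that is not absolutely
   summable the value is meaningless. *)
Definition rsum (R : realType) (T : choiceType) (f : T -> R) : R :=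
  fine (\esum_(t in [set: T]) ((EFin \o f)^\+)%E t
        - \esum_(t in [set: T]) ((EFin \o f)^\-)%E t)%E.

Definition csum (R : realType) (T : choiceType) (f : T -> R[i]) : R[i] :=
  rsum (fun t => complex.Re (f t)) +i* rsum (fun t => complex.Im (f t)).

Section WeightedGraphOperators.
Variables (R : realType) (K : weighted_graph R).
Local Notation V := (vertex K).
Local Notation E := (edge K).
Local Notation c := (@vweight R K).
Local Notation r := (@eweight R K).

(* The norms take values in \bar R and are +oo off the L2 spaces. *)
Definition norm0 (f : V -> R[i]) : \bar R :=
  sqrte (\esum_(v in [set: V]) (c v * Normc.normc (f v) ^+ 2)%:E).

Definition norm1 (phi : E -> R[i]) : \bar R :=
  sqrte ((2^-1)%:E * \esum_(e in [set: E]) (r e * Normc.normc (phi e) ^+ 2)%:E).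

Definition L2V (f : V -> R[i]) : Prop := (norm0 f < +oo)%E.

Definition L2E (phi : E -> R[i]) : Prop :=
  antisymmetric1 phi /\ (norm1 phi < +oo)%E.

Definition C01 (phi : E -> R[i]) : Prop := antisymmetric1 phi /\ fin_supp phi.

Definition delta (phi : E -> R[i]) (x : V) : R[i] :=
  (c x)^-1%:C * \sum_(e \in [set e : E | edge_head e = x]) ((r e)%:C * phi e).

(* [delta_bar phi f] means that phi is in the domain of the closure of delta
   and is mapped to f: the pair (phi, f) lies in the closure, in
   L2(E) x L2(V), of the graph of delta restricted to C01. *)
Definition delta_bar (phi : E -> R[i]) (f : V -> R[i]) : Prop :=
  [/\ L2E phi, L2V f &
    exists phi_ : nat -> E -> R[i],
      [/\ forall n, C01 (phi_ n),
          norm1 (phi_ n \- phi) @[n --> \oo] --> 0%E &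
          norm0 (delta (phi_ n) \- f) @[n --> \oo] --> 0%E]].

Definition chain1 (z : E -> int) : Prop := antisymmetric1 z.

Definition boundary (z : E -> int) (x : V) : int :=
  \sum_(e \in [set e : E | edge_head e = x]) z e.

Definition cycle1 (z : E -> int) : Prop :=
  chain1 z /\ forall x, boundary z x = 0.

Definition chain_cochain (z : E -> int) (e : E) : R[i] :=
  (z e)%:~R / (r e)%:C.

Definition L2_cycle (z : E -> int) : Prop :=
  cycle1 z /\ L2E (chain_cochain z).

(* For z an L2-cycle and phi in L2(E), the family is absolutely summable by the
   Cauchy-Schwarz inequality. *)
Definition chain_integral (z : E -> int) (phi : E -> R[i]) : R[i] :=
  2^-1 * csum (fun e => (z e)%:~R * phi e).

Definition chi_complete : Prop :=
  exists (B : nat -> set V) (chi : nat -> V -> R),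
    [/\ forall n, finite_set (B n),
        forall m n, (m <= n)%N -> B m `<=` B n &
        \bigcup_n B n = [set: V]] /\
    [/\ forall n, fin_supp (chi n),
        forall n v, 0 <= chi n v <= 1,
        forall n v, B n v -> chi n v = 1 &
        exists2 C : R, 0 < C & forall n x,
          (c x)^-1 * \sum_(e \in [set e : E | edge_head e = x \/ edge_tail e = x])
                       (r e * coboundary (chi n) e ^+ 2) <= C].

Definition solution (i : V -> R[i]) (E' I : E -> R[i]) : Prop :=
  (exists2 f, delta_bar I f & forall v, f v + i v = 0) /\
  forall z, L2_cycle z -> chain_integral z E' = chain_integral z I.

Definition minimal_energy_solution (i : V -> R[i]) (E' I : E -> R[i]) : Prop :=
  solution i E' I /\ forall J, solution i E' J -> (norm1 I <= norm1 J)%E.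

End WeightedGraphOperators.

(* Main.v *)
Require Import Defs.
From mathcomp Require Import all_boot all_order all_algebra.
From mathcomp Require Import all_classical all_reals all_analysis.
From mathcomp Require Import finmap complex ring lra.
Set Implicit Arguments.
Unset Strict Implicit.
Unset Printing Implicit Defensive.
Import Order.TTheory GRing.Theory Num.Theory.
Import numFieldNormedType.Exports.
Local Open Scope classical_set_scope.
Local Open Scope ring_scope.
Local Open Scope complex_scope.

(* Cutting off with the functions chi_n shows that, for f finitely supported,
   delta_bar phi = f exactly when phi is in L2(E) and delta phi = f pointwise;
   in particular every E_Z lies in the kernel of delta_bar.  All conditions on
   I having real coefficients, the problem splits into real and imaginary parts.

   Connectedness and sum c i = 0 give an L2 solution of delta I = - i, by adding
   up flows along paths.  Among all such solutions let I0 be the one closest to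
   E'.  Then E' - I0 is orthogonal to the divergence-free L2 fields, hence to
   every E_Z, so that I0 solves the problem.  The solutions form a closed affine
   subspace of L2(E), which has a unique element of minimal norm. *)

(** * Sums of real families *)

(** The domain of the closure of delta is accessible only through finitely supported approximants,
    and here chi-completeness enters. Multiplying phi by the mean of chi_n over the two ends of an
    edge keeps antisymmetry, and the divergence of the product is chi_n delta phi up to a gradient
    term. The main part equals f for large n because f has finite support. By Cauchy-Schwarz and
    condition (iii), the gradient term is controlled by the energy of phi on the edges where d chi_n
    is nonzero, and these edges eventually avoid any finite set.

    Two minimizations occur because the E_Z come from integer coefficients: their closed real span
    may be smaller than the space of divergence-free L2 fields. Projecting along the larger space
    yields a solution I0, but then solutions are not unique and I0 need not have least energy.

    Squared norms of real and imaginary parts add up, so the two real minimizers combine into a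
    complex one, and uniqueness follows from the equality case in each part. *)

Lemma maxrBN (R : realDomainType) (x : R) : x = Num.max x 0 - Num.max (- x) 0.
Proof.
by case: (lerP x 0) => ?; case: (lerP (- x) 0) => ?; lra.
Qed.

Lemma fine_le_EFin (R : realDomainType) (x : \bar R) (e : R) :
  (x <= e%:E)%E -> (0 <= x)%E -> fine x <= e.
Proof. by case: x => [x| |]; rewrite ?lee_fin. Qed.

Lemma seq_cvg_unique (R : realType) (u : nat -> R) (x y : R) :
  u n @[n --> \oo] --> x -> u n @[n --> \oo] --> y -> x = y.
Proof. by move=> ux uy; exact: (@norm_cvg_unique _ _ _ _ _ _ ux uy). Qed.

Lemma eq_seq_cvg (T : topologicalType) (u v : nat -> T) (l : T) :
  u =1 v -> u n @[n --> \oo] --> l -> v n @[n --> \oo] --> l.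
Proof. by move=> /funext ->. Qed.

Section Sums.
Context {R : realType} {T : choiceType}.
Implicit Types (f g h a b : T -> R).

Definition psum f : \bar R := (\esum_(t in [set: T]) (f t)%:E)%E.
Definition rsummable f : Prop := (psum (fun t => `|f t|%R) < +oo)%E.

Lemma psum_ge0 f : (forall t, 0 <= f t) -> (0 <= psum f)%E.
Proof. by move=> f0; apply: esum_ge0 => t _; rewrite lee_fin. Qed.

Lemma le_psum f g : (forall t, f t <= g t) -> (psum f <= psum g)%E.
Proof. by move=> fg; apply: le_esum => t _; rewrite lee_fin. Qed.

Lemma psumD f g : (forall t, 0 <= f t) -> (forall t, 0 <= g t) ->
  psum (fun t => f t + g t) = (psum f + psum g)%E.
Proof. by move=> f0 g0; rewrite -esumD// => t _; rewrite lee_fin. Qed.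

Lemma psum_le f (d : \bar R) :
  (forall F : {fset T}, ((\sum_(t <- F) f t)%:E <= d)%E) -> (psum f <= d)%E.
Proof.
move=> fd; apply: ge_ereal_sup => _ [X [finX _] <-].
by rewrite fsbig_finite//= sumEFin.
Qed.

Lemma psum_ge f (F : {fset T}) : ((\sum_(t <- F) f t)%:E <= psum f)%E.
Proof.
apply: esum_ge; exists [set` F]; first by split.
by rewrite -fsbig_seq// sumEFin.
Qed.

Lemma psum_ge1 f t : ((f t)%:E <= psum f)%E.
Proof. by have := psum_ge f [fset t]%fset; rewrite big_seq_fset1. Qed.

Lemma psum_fset (F : {fset T}) f :
  (forall t, 0 <= f t) -> (forall t, t \notin F -> f t = 0) ->
  psum f = (\sum_(t <- F) f t)%:E.
Proof.
move=> f0 fF; transitivity (\esum_(t in [set` F]) (f t)%:E)%E.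
  rewrite esum_mkcond; apply: eq_esum => t _; case: ifPn => //.
  by rewrite notin_setE/= => /negP /fF ->.
rewrite esum_fset ?fsbig_finite ?set_fsetK ?sumEFin//.
by move=> t _; rewrite lee_fin.
Qed.

Lemma psumZ (k : R) f : 0 <= k -> psum (fun t => k * f t) = (k%:E * psum f)%E.
Proof.
rewrite le_eqVlt => /predU1P[<-|k0].
  by rewrite mul0e /psum esum1// => t _; rewrite mul0r.
(* One inequality for all positive factors suffices: applied to k^-1 it gives the reverse one. *)
have H (l : R) g : 0 < l -> (psum (fun t => l * g t)%R <= l%:E * psum g)%E.
  move=> l0; apply: psum_le => F.
  by rewrite -mulr_sumr EFinM lee_pmul2l ?fin_numE ?lte_fin// psum_ge.
apply/eqP; rewrite eq_le H//= -lee_pdivlMl//.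
apply: le_trans (H k^-1 _ _); last by rewrite invr_gt0.
by apply: le_psum => t; rewrite mulKf// gt_eqF.
Qed.

Lemma eq_psum f g : f =1 g -> psum f = psum g.
Proof. by move=> /funext ->. Qed.

Lemma rsumE f : rsum f =
  fine (psum (fun t => Num.max (f t) 0)%R - psum (fun t => Num.max (- f t) 0)%R).
Proof.
rewrite /rsum /psum; congr (fine (_ - _)%E); apply: eq_esum => t _.
  by rewrite funeposE/= EFin_max.
by rewrite funenegE/= EFin_max.
Qed.

(* Any decomposition into nonnegative summable families computes [rsum], not only
   the one into positive and negative parts. *)
Lemma rsumB a b : (forall t, 0 <= a t) -> (forall t, 0 <= b t) ->
  (psum a < +oo)%E -> (psum b < +oo)%E ->
  rsum (fun t => a t - b t) = fine (psum a) - fine (psum b).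
Proof.
move=> a0 b0 fa fb.
have fa' : psum a \is a fin_num by rewrite ge0_fin_numE ?psum_ge0.
have fb' : psum b \is a fin_num by rewrite ge0_fin_numE ?psum_ge0.
rewrite -fineB// rsumE; congr fine.
set p := fun t => _; set n := fun t => Num.max (- _) _.
have p0 t : 0 <= p t by rewrite le_max lexx orbT.
have n0 t : 0 <= n t by rewrite le_max lexx orbT.
have fp : psum p \is a fin_num.
  rewrite ge0_fin_numE ?psum_ge0//; apply: le_lt_trans fa; apply: le_psum => t.
  by rewrite ge_max a0 lerBlDr lerDl b0.
have fn : psum n \is a fin_num.
  rewrite ge0_fin_numE ?psum_ge0//; apply: le_lt_trans fb; apply: le_psum => t.
  by rewrite ge_max b0 opprB lerBlDr lerDl a0.
(* Pointwise p - n = a - b; moved across, this becomes an identity between sums of nonnegative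
   families, to which [psumD] applies. *)
have : (psum p + psum b = psum n + psum a)%E.
  rewrite -!psumD//; apply: eq_psum => t; rewrite /p /n.
  by have := maxrBN (a t - b t); lra.
rewrite -(fineK fp) -(fineK fn) -(fineK fa') -(fineK fb') -!EFinD => -[H].
by congr EFin; lra.
Qed.

Lemma rsummable_ge0 f : (forall t, 0 <= f t) -> rsummable f <-> (psum f < +oo)%E.
Proof.
by move=> f0; rewrite /rsummable (eq_psum (g := f))// => t; rewrite ger0_norm.
Qed.

Lemma le_rsummable f g : (forall t, `|f t| <= g t) -> rsummable g -> rsummable f.
Proof.
move=> fg; apply: le_lt_trans; apply: le_psum => t.
by rewrite (le_trans (fg t))// ler_norm.
Qed.

Lemma rsummableD f g : rsummable f -> rsummable g ->
  rsummable (fun t => f t + g t).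
Proof.
move=> sf sg; apply: (@le_lt_trans _ _ (psum (fun t => `|f t| + `|g t|)%R)).
  by apply: le_psum => t; rewrite ler_normD.
by rewrite psumD// lte_add_pinfty.
Qed.

Lemma rsummable_pm f : rsummable f ->
  exists a b, [/\ forall t, 0 <= a t, forall t, 0 <= b t, (psum a < +oo)%E,
    (psum b < +oo)%E & f = fun t => a t - b t].
Proof.
move=> sf; exists (fun t => Num.max (f t) 0), (fun t => Num.max (- f t) 0).
split.
- by move=> t; rewrite le_max lexx orbT.
- by move=> t; rewrite le_max lexx orbT.
- apply: le_lt_trans sf; apply: le_psum => t.
  by rewrite ge_max ler_norm normr_ge0.
- apply: le_lt_trans sf; apply: le_psum => t.
  by rewrite ge_max ler_normr lexx orbT normr_ge0.
- by apply/funext => t; exact: maxrBN.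
Qed.

Lemma rsumD f g : rsummable f -> rsummable g ->
  rsum (fun t => f t + g t) = rsum f + rsum g.
Proof.
move=> /rsummable_pm[a [b [a0 b0 fa fb ->]]] /rsummable_pm[c [d [c0 d0 fc fd ->]]].
rewrite (_ : (fun t => _) = fun t => (a t + c t) - (b t + d t)); last first.
  by apply/funext => t; lra.
rewrite !rsumB ?psumD ?lte_add_pinfty//; last 2 first.
- by move=> t; rewrite addr_ge0.
- by move=> t; rewrite addr_ge0.
rewrite !fineD ?ge0_fin_numE ?psum_ge0//; lra.
Qed.

Lemma rsumZ k f : rsummable f -> rsum (fun t => k * f t) = k * rsum f.
Proof.
move=> /rsummable_pm[a [b [a0 b0 fa fb ->]]].
(* Splitting k into its positive and negative parts as well exhibits the product as a difference of
   nonnegative families, whatever the sign of k. *)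
rewrite (_ : (fun t => _) = fun t =>
  (Num.max k 0 * a t + Num.max (- k) 0 * b t) -
  (Num.max k 0 * b t + Num.max (- k) 0 * a t)); last first.
  apply/funext => t; have := maxrBN k.
  by move: (Num.max k 0) (Num.max (- k) 0) => m n ->; ring.
have kp : 0 <= Num.max k 0 by rewrite le_max lexx orbT.
have kn : 0 <= Num.max (- k) 0 by rewrite le_max lexx orbT.
have := maxrBN k; move: (Num.max k 0) (Num.max (- k) 0) kp kn => m n m0 n0 kE.
have psum2 c d : (forall t, 0 <= c t) -> (forall t, 0 <= d t) ->
    (psum c < +oo)%E -> (psum d < +oo)%E ->
    psum (fun t => m * c t + n * d t) = (m * fine (psum c) + n * fine (psum d))%:E.
  move=> c0 d0 fc fd; rewrite EFinD !EFinM !fineK ?ge0_fin_numE ?psum_ge0//.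
  by rewrite -!psumZ// psumD// => t; rewrite mulr_ge0.
rewrite [in RHS]rsumB// rsumB; try by move=> t; rewrite ?addr_ge0 ?mulr_ge0.
- by rewrite !psum2// kE /=; ring.
- by rewrite psum2// ltry.
- by rewrite psum2// ltry.
Qed.

Lemma rsum_psum f : (forall t, 0 <= f t) -> (psum f < +oo)%E ->
  (rsum f)%:E = psum f.
Proof.
move=> f0 ff; rewrite (_ : f = fun t => f t - 0); last first.
  by apply/funext => t; rewrite subr0.
have p0 : psum (fun=> 0) = 0%E by apply: esum1.
rewrite rsumB// ?p0 ?lte_pinfty// subr0 fineK ?ge0_fin_numE ?psum_ge0//.
by apply: eq_psum => t; rewrite subr0.
Qed.

(** Fatou's lemma for sums: each finite partial sum passes to the limit, and [psum] is the supremum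
    of these. Allowing a slack e lets it apply directly to minimizing sequences. *)
Lemma psum_fatou (f_ : nat -> T -> R) f (d : R) :
  (forall t, f_ n t @[n --> \oo] --> f t) ->
  (forall e, 0 < e -> \forall n \near \oo, (psum (f_ n) <= (d + e)%:E)%E) ->
  (psum f <= d%:E)%E.
Proof.
move=> ff H; apply: psum_le => F; rewrite lee_fin.
apply/ler_addgt0Pr => e e0.
have c : (\sum_(t <- F) f_ n t) @[n --> \oo] --> \sum_(t <- F) f t.
  by apply: cvg_big => // [[x y]]; exact: add_continuous.
rewrite -(cvg_lim _ c)//; apply: limr_le; first by apply/cvg_ex; eexists; exact: c.
near=> n; rewrite -lee_fin; apply: le_trans (psum_ge _ _) _.
by near: n; exact: H.
Unshelve. all: by end_near. Qed.

Lemma psum_tail f : (forall t, 0 <= f t) -> (psum f < +oo)%E ->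
  forall e, 0 < e -> exists F : {fset T},
    (psum (fun t => if t \in F then 0 else f t)%R <= e%:E)%E.
Proof.
move=> f0 ff e e0.
have fn : psum f \is a fin_num by rewrite ge0_fin_numE ?psum_ge0.
have [_ [X [finX _] <-]] := ub_ereal_sup_adherent e0 fn.
rewrite fsbig_finite//= sumEFin; rewrite -[ereal_sup _]/(psum f).
set F := fset_set X => H.
exists F.
have : psum f = (psum (fun t => if t \in F then f t else 0)%R +
                 psum (fun t => if t \in F then 0 else f t)%R)%E.
  rewrite -psumD; first by apply: eq_psum => t; case: ifP; rewrite ?addr0 ?add0r.
  - by move=> t; case: ifP.
  - by move=> t; case: ifP.
have := psum_ge (fun t => if t \in F then f t else 0) F.
rewrite -big_mkcond/= -big_seq; move: H.
have p0 : (0 <= psum (fun t => if t \in F then f t else 0)%R)%E.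
  by apply: psum_ge0 => t; case: ifP.
have q0 : (0 <= psum (fun t => if t \in F then 0 else f t)%R)%E.
  by apply: psum_ge0 => t; case: ifP.
move: p0 q0; set p := psum (fun=> _); set q := psum (fun t => if _ then 0 else _).
rewrite -(fineK fn); move: (fine (psum f)) p q => S [p| |] [q| |] //.
by rewrite -EFinB !lte_fin !lee_fin => ? ? ? ? [?]; lra.
Qed.

Lemma cvge0P (u : nat -> \bar R) : (forall n, (0 <= u n)%E) ->
  u n @[n --> \oo] --> 0%E <->
  (forall e, 0 < e -> \forall n \near \oo, (u n <= e%:E)%E).
Proof.
move=> u0; split=> [/fine_cvgP[fu /cvgrPdist_le uc] e e0|H].
  near=> n; have fn : u n \is a fin_num by near: n.
  have : `|0 - fine (u n)| <= e by near: n; exact: uc.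
  by rewrite sub0r normrN -{2}(fineK fn) lee_fin; apply: le_trans; rewrite ler_norm.
apply/fine_cvgP; split.
  near=> n; rewrite ge0_fin_numE//; apply: (@le_lt_trans _ _ 1%:E); last exact: ltry.
  by near: n; exact: H.
apply/cvgrPdist_le => e e0; near=> n; rewrite sub0r normrN ger0_norm ?fine_ge0//.
have : (u n <= e%:E)%E by near: n; exact: H.
by move=> /fine_le_EFin; exact.
Unshelve. all: by end_near. Qed.

Lemma near_fset (P : nat -> T -> Prop) (F : {fset T}) :
  (forall t, \forall n \near \oo, P n t) ->
  \forall n \near \oo, forall t, t \in F -> P n t.
Proof.
move=> H; suff: forall s : seq T, \forall n \near \oo, forall t, t \in s -> P n t.
  by move=> /(_ (F : seq T)).
elim=> [|x s IH]; first by near=> n.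
near=> n => t; rewrite inE => /predU1P[->|ts]; first by near: n.
by move: t ts; near: n.
Unshelve. all: by end_near. Qed.

(** Dominated convergence when each term is eventually zero, as the cut-offs provide: off a finite
    set the tail of g is small, and on that set all terms vanish for large n. *)
Lemma psum_dominated (f_ : nat -> T -> R) g :
  (forall n t, 0 <= f_ n t <= g t) -> (psum g < +oo)%E ->
  (forall t, \forall n \near \oo, f_ n t = 0) ->
  psum (f_ n) @[n --> \oo] --> 0%E.
Proof.
move=> fg gfin f0; apply/cvge0P => [n|e e0].
  by apply: psum_ge0 => t; have /andP[] := fg n t.
have g0 t : 0 <= g t by have /andP[/le_trans] := fg 0 t; apply.
have [F FP] := psum_tail g0 gfin e0.
near=> n; apply: le_trans FP; apply: le_psum => t.
case: ifPn => tF; last by have /andP[] := fg n t.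
suff -> : f_ n t = 0 by [].
by move: t tF; near: n; exact: near_fset.
Unshelve. all: by end_near. Qed.
End Sums.

(** * Weighted real l2 spaces *)

Section L2.
Context {R : realType} {T : choiceType}.
Variables (w : T -> R) (w_gt0 : forall t, 0 < w t).
Implicit Types (f g h : T -> R).

(** Kept in the extended reals so that [l2] is plain finiteness; the real-valued [dot] is meaningful
    on [l2], where [dotxx] relates the two. *)
Definition sqn f : \bar R := psum (fun t => w t * f t ^+ 2).
Definition l2 f : Prop := (sqn f < +oo)%E.
Definition dot f g : R := rsum (fun t => w t * f t * g t).

Lemma wsqr_ge0 f t : 0 <= w t * f t ^+ 2.
Proof. by rewrite mulr_ge0 ?sqr_ge0// ltW. Qed.
#[local] Hint Resolve wsqr_ge0 : core.

Lemma sqn_ge0 f : (0 <= sqn f)%E.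
Proof. exact: psum_ge0. Qed.

(** From |xy| <= x^2 + y^2. Cauchy-Schwarz cannot serve here: it is derived below from the
    bilinearity of [dot], which rests on this summability. *)
Lemma l2_summable f g : l2 f -> l2 g -> rsummable (fun t => w t * f t * g t).
Proof.
move=> lf lg.
apply: (@le_rsummable _ _ _ (fun t => w t * f t ^+ 2 + w t * g t ^+ 2)).
  move=> t; rewrite -mulrA normrM (gtr0_norm (w_gt0 t)) -mulrDr ler_pM2l// normrM.
  rewrite -(real_normK (num_real (f t))) -(real_normK (num_real (g t))).
  have := sqr_ge0 (`|f t| - `|g t|); have := sqr_ge0 `|f t|; have := sqr_ge0 `|g t|.
  by nra.
by apply: rsummableD; apply/rsummable_ge0.
Qed.

Lemma l2Z k f : l2 f -> l2 (k *: f).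
Proof.
rewrite /l2 /sqn => lf.
rewrite (eq_psum (g := fun t => k ^+ 2 * (w t * f t ^+ 2))); last first.
  by move=> t; rewrite fctE/= /GRing.scale/=; ring.
by rewrite psumZ ?sqr_ge0// lte_mul_pinfty// ?lee_fin ?sqr_ge0// psum_ge0.
Qed.

Lemma l2D f g : l2 f -> l2 g -> l2 (f + g).
Proof.
move=> lf lg; apply: (@le_lt_trans _ _
  (psum (fun t => 2 * (w t * f t ^+ 2) + 2 * (w t * g t ^+ 2))%R)).
  apply: le_psum => t; rewrite fctE.
  by have := mulr_ge0 (ltW (w_gt0 t)) (sqr_ge0 (f t - g t)); lra.
rewrite psumD ?psumZ//; try by move=> t; rewrite mulr_ge0.
by rewrite lte_add_pinfty// lte_mul_pinfty// psum_ge0.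
Qed.

Lemma l2N f : l2 f -> l2 (- f).
Proof. by rewrite -scaleN1r; exact: l2Z. Qed.

Lemma l2B f g : l2 f -> l2 g -> l2 (f - g).
Proof. by move=> lf /l2N; exact: l2D. Qed.

Lemma dotC f g : dot f g = dot g f.
Proof. by congr rsum; apply/funext => t; rewrite mulrAC. Qed.

Lemma dotDl f g h : l2 f -> l2 g -> l2 h -> dot (f + g) h = dot f h + dot g h.
Proof.
move=> lf lg lh; rewrite /dot -rsumD; [|exact: l2_summable..].
by congr rsum; apply/funext => t; rewrite fctE; ring.
Qed.

Lemma dotZl k f h : l2 f -> l2 h -> dot (k *: f) h = k * dot f h.
Proof.
move=> lf lh; rewrite /dot -rsumZ; last exact: l2_summable.
by congr rsum; apply/funext => t; rewrite fctE /GRing.scale/=; ring.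
Qed.

Lemma dotBl f g h : l2 f -> l2 g -> l2 h -> dot (f - g) h = dot f h - dot g h.
Proof.
by move=> lf lg lh; rewrite dotDl//; [rewrite -scaleN1r dotZl ?mulN1r|exact: l2N].
Qed.

Lemma dotDr f g h : l2 f -> l2 g -> l2 h -> dot h (f + g) = dot h f + dot h g.
Proof. by move=> lf lg lh; rewrite dotC dotDl// !(dotC h). Qed.

Lemma dotZr k f h : l2 f -> l2 h -> dot h (k *: f) = k * dot h f.
Proof. by move=> lf lh; rewrite dotC dotZl// (dotC h). Qed.

Lemma dotxx f : l2 f -> (dot f f)%:E = sqn f.
Proof.
move=> lf; rewrite /sqn -rsum_psum//; congr (_%:E); congr rsum.
by apply/funext => t; rewrite expr2 mulrA.
Qed.

Lemma dotxx_ge0 f : l2 f -> 0 <= dot f f.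
Proof. by move=> lf; rewrite -lee_fin dotxx// sqn_ge0. Qed.

Lemma dotxx_ge1 f t : l2 f -> w t * f t ^+ 2 <= dot f f.
Proof. by move=> lf; rewrite -lee_fin dotxx//; exact: psum_ge1. Qed.

Lemma dotxx_eq0 f : l2 f -> dot f f <= 0 -> f = 0.
Proof.
move=> lf f0; apply/funext => t; apply/eqP; rewrite -sqrf_eq0 eq_le sqr_ge0 andbT.
by rewrite -(ler_pM2l (w_gt0 t)) mulr0; apply: le_trans f0; exact: dotxx_ge1.
Qed.

Lemma l20 : l2 0.
Proof.
rewrite /l2 /sqn /psum esum1 ?ltry// => t _.
by rewrite /= expr0n mulr0.
Qed.

Lemma dotDxx f g s : l2 f -> l2 g ->
  dot (f + s *: g) (f + s *: g) = dot f f + 2 * s * dot f g + s ^+ 2 * dot g g.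
Proof.
move=> lf lg; have lsg := l2Z s lg.
have lfsg := l2D lf lsg.
by rewrite dotDl// !dotDr// !dotZl// !dotZr// (dotC g f); ring.
Qed.

Lemma dot_cauchy_schwarz f g : l2 f -> l2 g -> dot f g ^+ 2 <= dot f f * dot g g.
Proof.
move=> lf lg; have := dotxx_ge0 lg; rewrite le_eqVlt => /predU1P[g0|g0].
  have -> : g = 0 by apply: dotxx_eq0 => //; rewrite -g0.
  have -> : dot f 0 = 0 by rewrite -(scale0r f) dotZr// mul0r.
  by rewrite expr0n/= mulr_ge0 ?dotxx_ge0//; exact: l20.
(* The coefficient is the one that minimizes the norm of f + s g over all s. *)
have := dotxx_ge0 (l2D lf (l2Z (- (dot f g / dot g g)) lg)).
rewrite dotDxx// => H; rewrite -subr_ge0.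
rewrite [leRHS](_ : _ = dot g g *
  (dot f f + 2 * - (dot f g / dot g g) * dot f g +
    (- (dot f g / dot g g)) ^+ 2 * dot g g)).
  by rewrite mulr_ge0// ltW.
by field; rewrite gt_eqF.
Qed.

Lemma parallelogram f g : l2 f -> l2 g ->
  dot (f - g) (f - g) + 4 * dot (2^-1 *: (f + g)) (2^-1 *: (f + g)) =
  2 * (dot f f + dot g g).
Proof.
move=> lf lg; have lfg := l2D lf lg.
rewrite dotZl ?dotZr//; last exact: l2Z.
have := dotDxx (-1) lf lg; have := dotDxx 1 lf lg.
by rewrite scaleN1r scale1r => -> ->; field.
Qed.

(** * Completeness and elements of minimal norm *)

Definition l2_closed (P : set (T -> R)) : Prop := forall p_ p,
  (forall n, P (p_ n)) -> l2 p -> dot (p_ n - p) (p_ n - p) @[n --> \oo] --> 0 ->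
  P p.

Lemma wsqr_le t x e : 0 <= e -> w t * x ^+ 2 <= w t * e ^+ 2 -> `|x| <= e.
Proof.
move=> e0; rewrite (ler_pM2l (w_gt0 t)) -(real_normK (num_real x)).
by rewrite ler_pXn2r ?nnegrE.
Qed.

Lemma sqn_cvg_pointwise (p_ : nat -> T -> R) p :
  sqn (p_ n - p) @[n --> \oo] --> 0%E -> forall t, p_ n t @[n --> \oo] --> p t.
Proof.
move=> /cvge0P pp t; apply/cvgrPdist_le => e e0.
have e20 : 0 < w t * e ^+ 2 by rewrite mulr_gt0// exprn_gt0.
near=> n; apply: (@wsqr_le t); first exact: ltW.
rewrite -lee_fin; apply: (@le_trans _ _ (sqn (p_ n - p)%R)).
  have := psum_ge1 (fun t => w t * (p_ n - p) t ^+ 2) t.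
  by rewrite !fctE -sqrrN opprB.
by near: n; apply: pp => // n; exact: sqn_ge0.
Unshelve. all: by end_near. Qed.

Lemma l2_cvg_pointwise p_ p : (forall n, l2 (p_ n)) -> l2 p ->
  dot (p_ n - p) (p_ n - p) @[n --> \oo] --> 0 ->
  forall t, p_ n t @[n --> \oo] --> p t.
Proof.
move=> lp_ lp pp; apply: sqn_cvg_pointwise.
apply: (@eq_seq_cvg _ (fun n => (dot (p_ n - p) (p_ n - p))%:E)).
  by move=> n; rewrite dotxx//; exact: l2B.
by apply: cvg_EFin => //; near=> n.
Unshelve. all: by end_near. Qed.

(** Riesz-Fischer. As the weights are positive, the energy of a difference bounds its value at each
    index, so pointwise limits exist. Fatou, with one of the two indices sent to infinity, turns
    them into a limit in norm. *)
Lemma l2_complete p_ : (forall n, l2 (p_ n)) ->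
  (forall e, 0 < e -> exists N, forall m n, (N <= m)%N -> (N <= n)%N ->
     dot (p_ m - p_ n) (p_ m - p_ n) <= e) ->
  exists2 p, l2 p & dot (p_ n - p) (p_ n - p) @[n --> \oo] --> 0.
Proof.
move=> lp cau.
have ptc t : exists l : R, p_ n t @[n --> \oo] --> l.
  exists (lim (p_ n t @[n --> \oo])); apply/cauchy_cvgP; apply/cauchy_exP => e e0.
  have e20 : 0 < w t * (e / 2) ^+ 2 by rewrite mulr_gt0// exprn_gt0// divr_gt0.
  have [N HN] := cau _ e20; exists (p_ N t).
  suff: \forall n \near \oo, ball (p_ N t) e (p_ n t) by [].
  near=> n.
  apply: (@le_lt_trans _ _ (e / 2)); last by rewrite gtr_pMr// invf_lt1 ?ltr1n.
  apply: (@wsqr_le t); first by rewrite ltW// divr_gt0.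
  apply: (@le_trans _ _ (dot (p_ N - p_ n) (p_ N - p_ n))).
    exact: (dotxx_ge1 t (l2B (lp N) (lp n))).
  by apply: HN => //; near: n; exact: nbhs_infty_ge.
have [p pc] := choice ptc.
have H e : 0 < e -> exists N, forall n, (N <= n)%N -> (sqn (p_ n - p)%R <= e%:E)%E.
  move=> e0; have [N HN] := cau e e0; exists N => n Nn.
  apply: (@psum_fatou _ _ (fun m t => w t * (p_ n t - p_ m t) ^+ 2)).
    move=> t; apply: cvgM; first exact: cvg_cst.
    by apply: cvgM; apply: cvgB; [exact: cvg_cst|exact: pc|exact: cvg_cst|exact: pc].
  move=> d d0; near=> m.
  have -> : psum (fun t => w t * (p_ n t - p_ m t) ^+ 2) = sqn (p_ n - p_ m) by [].
  rewrite -dotxx ?lee_fin; last exact: l2B.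
  rewrite (le_trans (HN _ _ _ _))// ?lerDl ?(ltW d0)//.
  by near: m; exact: nbhs_infty_ge.
have lp' : l2 p.
  have [N HN] := H 1 ltr01.
  have -> : p = p_ N - (p_ N - p) by rewrite opprB addrC subrK.
  by apply: l2B => //; apply: le_lt_trans (HN _ (leqnn _)) _; rewrite ltry.
exists p => //; apply/cvgrPdist_le => e e0; have [N HN] := H e e0.
near=> n; have lpn := l2B (lp n) lp'.
rewrite sub0r normrN ger0_norm ?dotxx_ge0// -lee_fin dotxx// HN//.
by near: n; exact: nbhs_infty_ge.
Unshelve. all: by end_near. Qed.

(** The parallelogram law makes a minimizing sequence Cauchy; of convexity it uses only stability
    under midpoints. *)
Lemma min_norm_ex (P : set (T -> R)) : P !=set0 -> P `<=` l2 -> l2_closed P ->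
  (forall f g, P f -> P g -> P (2^-1 *: (f + g))) ->
  exists2 p, P p & forall q, P q -> dot p p <= dot q q.
Proof.
move=> [p0 Pp0] Pl Pc Pm.
pose D := [set dot q q | q in P].
have Dlb : lbound D 0 by move=> _ [q Pq <-]; exact/dotxx_ge0/Pl.
have hD : has_inf D by split; [exists (dot p0 p0), p0|exists 0].
have dmin q : P q -> inf D <= dot q q by move=> Pq; apply: ge_inf; [exists 0|exists q].
have /choice[p_ Hp_] (n : nat) : exists q, P q /\ dot q q < inf D + n.+1%:R^-1.
  have [|_ [q Pq <-] qd] := @inf_adherent _ D n.+1%:R^-1 _ hD.
    by rewrite invr_gt0 ltr0n.
  by exists q.
have Pp_ n : P (p_ n) by have [] := Hp_ n.
have lp_ n : l2 (p_ n) by exact: Pl.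
have inv_le e : 0 < e -> exists N : nat, forall n, (N <= n)%N -> n.+1%:R^-1 <= e :> R.
  move=> e0; have [N _ HN] := near_infty_natSinv_lt (PosNum e0).
  by exists N => n /HN /ltW.
have [e e0|p lp pp] := l2_complete lp_.
  (* If both squared norms exceed the infimum by at most e / 4, the parallelogram law bounds that of
     the difference by 2 (e / 4 + e / 4) = e. *)
  have [N HN] := inv_le (e / 4) ltac:(by rewrite divr_gt0).
  exists N => m n /HN hm /HN hn.
  have := parallelogram (lp_ m) (lp_ n).
  have := dmin _ (Pm _ _ (Pp_ m) (Pp_ n)).
  have [_] := Hp_ m; have [_] := Hp_ n.
  move: hm hn; move: (m.+1%:R^-1) (n.+1%:R^-1) => a b; lra.
exists p; first exact: (Pc p_).
(* Lower semicontinuity of the norm, by Fatou, shows that the limit attains the infimum. *)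
move=> q /dmin; apply: le_trans; rewrite -lee_fin dotxx//.
apply: (@psum_fatou _ _ (fun n t => w t * p_ n t ^+ 2)).
  move=> t; apply: cvgM; first exact: cvg_cst.
  by apply: cvgM; exact: (l2_cvg_pointwise lp_ lp pp).
move=> e e0; have [N HN] := inv_le _ e0; near=> n.
have -> : psum (fun t => w t * p_ n t ^+ 2) = sqn (p_ n) by [].
rewrite -dotxx// lee_fin; have [_ /ltW h] := Hp_ n; apply: (le_trans h).
by rewrite lerD2l HN//; near: n; exact: nbhs_infty_ge.
Unshelve. all: by end_near. Qed.

Lemma min_norm_uniq (P : set (T -> R)) p q : P `<=` l2 -> 
  (forall f g, P f -> P g -> P (2^-1 *: (f + g))) ->
  P p -> (forall q, P q -> dot p p <= dot q q) -> P q -> dot q q <= dot p p ->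
  q = p.
Proof.
move=> Pl Pm Pp pmin Pq qp; apply/eqP; rewrite -subr_eq0; apply/eqP.
have [lp lq] := (Pl _ Pp, Pl _ Pq).
apply: dotxx_eq0; first exact: l2B.
(* The midpoint is no shorter than p, so the law leaves nothing for the difference. *)
have := parallelogram lq lp; have := pmin _ (Pm _ _ Pq Pp); lra.
Qed.

Lemma min_norm_orth (P : set (T -> R)) p k : l2 p -> l2 k ->
  (forall q, P q -> dot p p <= dot q q) -> (forall s, P (p + s *: k)) ->
  dot p k = 0.
Proof.
move=> lp lk pmin Pk; have := dotxx_ge0 lk; rewrite le_eqVlt => /predU1P[k0|k0].
  have -> : k = 0 by apply: dotxx_eq0 => //; rewrite -k0.
  by rewrite -(scale0r p) dotZr// mul0r.
(* The best step along k lowers the squared norm by <p,k>^2 / <k,k>, which minimality forces to be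
   zero. *)
have := pmin _ (Pk (- (dot p k / dot k k))).
rewrite dotDxx//.
rewrite [leRHS](_ : _ = dot p p - dot p k ^+ 2 / dot k k); last first.
  by field; rewrite gt_eqF.
rewrite lerBrDl -lerBrDr subrr pmulr_lle0 ?invr_gt0// => h.
by apply/eqP; rewrite -sqrf_eq0 eq_le h sqr_ge0.
Qed.

Lemma dot_cvg p_ p z : (forall n, l2 (p_ n)) -> l2 p -> l2 z ->
  dot (p_ n - p) (p_ n - p) @[n --> \oo] --> 0 ->
  dot (p_ n) z @[n --> \oo] --> dot p z.
Proof.
move=> lp_ lp lz /cvgrPdist_le pp; apply/cvgrPdist_le => e e0.
(* Adding 1 keeps the divisor positive when z = 0. *)
have z0 : 0 < dot z z + 1 by rewrite ltr_wpDl// dotxx_ge0.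
have e20 : 0 < e ^+ 2 / (dot z z + 1) by rewrite divr_gt0// exprn_gt0.
near=> n; have lpn := l2B (lp_ n) lp.
have : `|0 - dot (p_ n - p) (p_ n - p)| <= e ^+ 2 / (dot z z + 1).
  by near: n; exact: pp.
rewrite sub0r normrN ger0_norm ?dotxx_ge0// ler_pdivlMr// => h.
rewrite distrC -dotBl// -(@ler_pXn2r _ 2)// ?nnegrE ?(ltW e0)//.
rewrite real_normK ?num_real//; apply: (le_trans (dot_cauchy_schwarz lpn lz)).
by apply: le_trans h; rewrite ler_wpM2l ?dotxx_ge0// lerDl.
Unshelve. all: by end_near. Qed.

End L2.

(** * Real flows with prescribed inflow *)

Section Flows.
Context {R : realType} {K : weighted_graph R}.
Hypothesis lf : locally_finite K.
Local Notation V := (vertex K).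
Local Notation E := (edge K).
Local Notation c := (@vweight R K).
Local Notation r := (@eweight R K).
Implicit Types (phi psi : E -> R) (a b : V -> R).

Lemma opp_edgeK : involutive (@opp_edge K).
Proof. by case=> [[x y] xy]; apply: val_inj. Qed.

Lemma finite_in_edges (x : V) : finite_set [set e : E | edge_head e = x].
Proof. by apply: sub_finite_set (lf x) => e /= ->; left. Qed.

(* [inflow phi x] is [c x * delta phi x]. *)
Definition inflow phi (x : V) : R :=
  \sum_(e \in [set e : E | edge_head e = x]) r e * phi e.

Lemma inflowE phi x : inflow phi x =
  \sum_(e <- fset_set [set e : E | edge_head e = x]) r e * phi e.
Proof. by rewrite /inflow fsbig_finite//; exact: finite_in_edges. Qed.

Lemma cvg_inflow (p_ : nat -> E -> R) p x :
  (forall e, p_ n e @[n --> \oo] --> p e) ->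
  inflow (p_ n) x @[n --> \oo] --> inflow p x.
Proof.
move=> pt; under eq_fun do rewrite inflowE.
rewrite inflowE; apply: cvg_big => // [[u v]|e _]; first exact: add_continuous.
by apply: cvgM; [exact: cvg_cst|exact: pt].
Qed.

Lemma inflowD phi psi x : inflow (phi + psi) x = inflow phi x + inflow psi x.
Proof.
rewrite !inflowE -big_split/=; apply: eq_bigr => e _.
by rewrite fctE mulrDr.
Qed.

Lemma inflowZ k phi x : inflow (k *: phi) x = k * inflow phi x.
Proof.
rewrite !inflowE mulr_sumr; apply: eq_bigr => e _.
by rewrite fctE /GRing.scale/= mulrCA.
Qed.

(** Prescribing c times the divergence removes the vertex weights: the hypothesis that c i sums to
    zero becomes that a does. *)
Definition rflow a : set (E -> R) :=
  [set phi | [/\ antisymmetric1 phi, l2 r phi & forall x, inflow phi x = a x]].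

Lemma rflow_l2 a : rflow a `<=` l2 r.
Proof. by move=> phi []. Qed.

Lemma rflowD a b phi psi : rflow a phi -> rflow b psi -> rflow (a + b) (phi + psi).
Proof.
move=> [a1 l1 f1] [a2 l2 f2]; split.
- by move=> e; rewrite !fctE a1 a2 opprD.
- by apply: l2D => //; exact: eweight_gt0.
- by move=> x; rewrite inflowD f1 f2.
Qed.

Lemma rflowZ k a phi : rflow a phi -> rflow (k *: a) (k *: phi).
Proof.
move=> [a1 l1 f1]; split.
- by move=> e; rewrite !fctE a1 scalerN.
- by apply: l2Z => //; exact: eweight_gt0.
- by move=> x; rewrite inflowZ f1.
Qed.

Lemma rflow_mid a phi psi : rflow a phi -> rflow a psi ->
  rflow a (2^-1 *: (phi + psi)).
Proof.
move=> fa fb; have := rflowZ 2^-1 (rflowD fa fb).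
suff -> : 2^-1 *: (a + a) = a by [].
by apply/funext => x; rewrite !fctE /GRing.scale/=; field.
Qed.

Lemma rflow0 : rflow 0 0.
Proof.
split; [by move=> e; rewrite oppr0|exact: l20|move=> x].
by rewrite inflowE big1// => e _; rewrite mulr0.
Qed.

(** A unit current along one edge; the factor 1 / r e cancels the edge weight in [inflow]. *)
Lemma rflow_edge (e : E) :
  rflow (fun x => (x == edge_head e)%:R - (x == edge_tail e)%:R)
    (fun e' => ((e' == e)%:R - (e' == opp_edge e)%:R) / r e).
Proof.
split.
- move=> e'; rewrite -mulNr opprB (can2_eq opp_edgeK opp_edgeK).
  by rewrite (inj_eq (can_inj opp_edgeK)).
- rewrite /l2 /sqn (@psum_fset _ _ [fset e; opp_edge e]%fset) ?ltry//.
    by move=> t; rewrite mulr_ge0 ?sqr_ge0// ltW// eweight_gt0.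
  move=> t; rewrite !inE negb_or => /andP[/negbTE -> /negbTE ->].
  by rewrite subrr mul0r expr0n mulr0.
(* Stated for any edge of the same weight, so that it serves both e and its opposite. *)
- have delta1 (e1 : E) x : r e1 = r e ->
     \sum_(e' <- fset_set [set e' : E | edge_head e' = x])
       (r e' * ((e' == e1)%:R / r e)) = (x == edge_head e1)%:R :> R.
    move=> re; rewrite (bigID (pred1 e1))/= [X in _ + X]big1 ?addr0; last first.
      by move=> e' /negbTE ->; rewrite mul0r mulr0.
    rewrite big_fset_condE/=.
    have [->|xe] := eqVneq x (edge_head e1).
      rewrite (_ : [fset _ in _ | _]%fset = [fset e1]%fset).
        by rewrite big_seq_fset1 !eqxx re mul1r divff// gt_eqF// eweight_gt0.
      apply/fsetP => e'; rewrite !inE/= in_fset_set; last exact: finite_in_edges.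
      by apply/andP/eqP => [[_ /eqP]//|->]; rewrite mem_set.
    rewrite (_ : [fset _ in _ | _]%fset = fset0); first by rewrite big_seq_fset0.
    apply/fsetP => e'; rewrite !inE/= in_fset_set; last exact: finite_in_edges.
    by apply/negbTE/negP => /andP[/set_mem/= ex /eqP ee]; rewrite -ex ee eqxx in xe.
  move=> x; rewrite inflowE -(delta1 e x erefl).
  rewrite -(delta1 (opp_edge e) x (eweight_opp e)).
  by rewrite -sumrB; apply: eq_bigr => e' _; rewrite mulrBl mulrBr.
Qed.

Lemma rflow_path x p : path (@adj K) x p ->
  rflow (fun v => (v == last x p)%:R - (v == x)%:R) !=set0.
Proof.
elim: p x => [|y p IH] x /=.
  move=> _; exists 0; rewrite (_ : (fun=> _) = 0); first exact: rflow0.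
  by apply/funext => v; rewrite subrr.
move=> /andP[xy /IH[phi fphi]].
pose e : E := exist _ (x, y) xy.
exists (phi + fun e' => ((e' == e)%:R - (e' == opp_edge e)%:R) / r e).
have := rflowD fphi (rflow_edge e); congr (rflow _ _).
by apply/funext => v; rewrite !fctE/= addrA subrK.
Qed.

(** From a base vertex x, a current of strength a y is sent to each y in the support along a path.
    The total drawn from x is the sum of a, that is zero, so what arrives at each vertex is exactly
    a. *)
Lemma rflow_ex a : connected_graph K -> fin_supp a ->
  \sum_(v \in [set: V]) a v = 0 -> rflow a !=set0.
Proof.
move=> conn afin asum.
have afin' : finite_set [set v | a v != 0] by [].
pose F := fset_set [set v | a v != 0].
have aF v : v \notin F -> a v = 0.
  by rewrite in_fset_set// notin_setE/= => /negP; rewrite negbK => /eqP.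
have {}asum : \sum_(v <- F) a v = 0 by rewrite -fsbigTE.
(* The base vertex is taken in the support; if the support is empty, a = 0 and the zero flow
   does. *)
have [x0 x0F|F0] := pickP (fun v : F => true); last first.
  exists 0; rewrite (_ : a = 0); first exact: rflow0.
  apply/funext => v; apply: aF; apply/negP => vF.
  by have := F0 [` vF]%fset.
set x := val x0.
have H (s : seq V) :
    rflow (fun v => \sum_(y <- s) a y * ((v == y)%:R - (v == x)%:R)) !=set0.
  elim: s => [|y s [phi IH]].
    exists 0; rewrite (_ : (fun=> _) = 0); first exact: rflow0.
    by apply/funext => v; rewrite big_nil.
  have [p xp py] := conn x y; have [psi] := rflow_path xp.
  rewrite py => /(rflowZ (a y)) /rflowD /(_ IH) h.
  exists (a y *: psi + phi); move: h; congr (rflow _ _).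
  by apply/funext => v; rewrite big_cons.
have [phi] := H F; exists phi.
rewrite (_ : a = fun v => \sum_(y <- F) a y * ((v == y)%:R - (v == x)%:R))//.
apply/funext => v; under eq_bigr do rewrite mulrBr.
rewrite sumrB -mulr_suml asum mul0r subr0.
rewrite (bigID (pred1 v))/= [X in _ + X]big1 ?addr0; last first.
  by move=> y; rewrite eq_sym => /negbTE ->; rewrite mulr0.
have [vF|vF] := boolP (v \in F); last first.
  rewrite aF// big_seq_cond big1// => y /andP[yF /eqP yv].
  by rewrite -yv yF in vF.
rewrite -big_filter filter_pred1_uniq ?fset_uniq//.
by rewrite big_seq1 eqxx mulr1.
Qed.

(** Each defining equation involves finitely many edges, by local finiteness, hence survives
    pointwise limits. *)
Lemma rflow_closed a : l2_closed r (rflow a).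
Proof.
move=> p_ p Pp lp pc.
have lp_ n : l2 r (p_ n) by have [] := Pp n.
have pt := l2_cvg_pointwise (@eweight_gt0 R K) lp_ lp pc.
split => //.
- move=> e; have h := cvgN (pt e).
  apply: (seq_cvg_unique (pt (opp_edge e))).
  have -> : (fun n => p_ n (opp_edge e)) = (fun n => - p_ n e).
    by apply/funext => n; have [/(_ e)] := Pp n.
  exact: h.
- move=> x.
  apply: (seq_cvg_unique (cvg_inflow pt)).
  have -> : (fun n => inflow (p_ n) x) = (fun=> a x).
    by apply/funext => n; have [_ _ ->] := Pp n.
  exact: cvg_cst.
Qed.

(** Z is an arbitrary family because integer cycles form no real subspace. The equality case is
    included so that the statements for real and imaginary parts can be added without losing
    uniqueness. *)
Lemma min_energy_ex a (F : E -> R) (Z : set (E -> R)) :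
  rflow a !=set0 -> antisymmetric1 F -> l2 r F -> Z `<=` rflow 0 ->
  exists2 p, rflow a p /\ (forall z, Z z -> dot r p z = dot r F z) &
    forall q, rflow a q -> (forall z, Z z -> dot r q z = dot r F z) ->
      dot r p p <= dot r q q ?= iff (q == p).
Proof.
move=> [p1 fp1] aF lF ZF.
have r0 := @eweight_gt0 R K.
(* Passing to differences with F turns the search for the flow closest to F into one for an element
   of minimal norm. *)
pose P1 : set (E -> R) := [set q | rflow a (F - q)].
have lP1 q : P1 q -> l2 r q.
  move=> /rflow_l2 lq; have -> : q = F - (F - q) by rewrite subKr.
  exact: l2B.
have [q0 Pq0 qmin] : exists2 q, P1 q & forall q', P1 q' -> dot r q q <= dot r q' q'.
  apply: min_norm_ex => //.
  - by exists (F - p1); rewrite /P1/= subKr.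
  - move=> p_ p Pp lp pc; apply: (rflow_closed (p_ := fun n => F - p_ n)) => //.
      exact: l2B.
    suff -> : (fun n => dot r (F - p_ n - (F - p)) (F - p_ n - (F - p))) =
              (fun n => dot r (p_ n - p) (p_ n - p)) by [].
    apply/funext => n; have -> : F - p_ n - (F - p) = - (p_ n - p).
      by apply/funext => t; rewrite !fctE; ring.
    rewrite -scaleN1r; have lpn : l2 r (p_ n - p) by apply: l2B => //; exact: lP1.
    by rewrite dotZl ?dotZr ?mulN1r ?opprK//; exact: l2Z.
  - move=> f g Pf Pg; have := rflow_mid Pf Pg; congr (rflow _ _).
    by apply/funext => t; rewrite !fctE /GRing.scale/=; field.
have lq0 := lP1 _ Pq0.
have orth z : Z z -> dot r (F - q0) z = dot r F z.
  move=> /ZF fz; have lz := rflow_l2 fz.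
  rewrite dotBl// (min_norm_orth r0 lq0 lz qmin) ?subr0// => s.
  have := rflowD Pq0 (rflowZ (- s) fz); rewrite /P1/= scaler0 addr0.
  by rewrite scaleNr opprD addrA.
(* The flow F - q0 meets all conditions but is closest to F rather than to 0; it only shows that the
   set of solutions is nonempty, and a second minimization runs over that set. *)
pose P2 : set (E -> R) :=
  [set p | rflow a p /\ forall z, Z z -> dot r p z = dot r F z].
have P2l : P2 `<=` l2 r by move=> p [/rflow_l2].
have P2mid f g : P2 f -> P2 g -> P2 (2^-1 *: (f + g)).
  move=> [ff fz] [gf gz]; split; first exact: rflow_mid.
  move=> z Zz; have /rflow_l2 lz := ZF _ Zz.
  have [lf' lg'] := (rflow_l2 ff, rflow_l2 gf).
  rewrite dotZl//; last exact: l2D.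
  by rewrite dotDl// fz// gz//; field.
have [p P2p pmin] : exists2 p, P2 p & forall q, P2 q -> dot r p p <= dot r q q.
  apply: min_norm_ex => //; first by exists (F - q0).
  move=> p_ p Pp lp pc; split.
    by apply: (rflow_closed _ lp pc) => n; have [] := Pp n.
  move=> z Zz; have /rflow_l2 lz := ZF _ Zz.
  have lp_ n : l2 r (p_ n) by have [/rflow_l2] := Pp n.
  apply: (seq_cvg_unique (dot_cvg r0 lp_ lp lz pc)).
  have -> : (fun n => dot r (p_ n) z) = (fun=> dot r F z).
    by apply/funext => n; have [_ ->] := Pp n.
  exact: cvg_cst.
exists p => // q fq qz; have P2q : P2 q by [].
split; first exact: pmin.
apply/eqP/eqP => [pq|->//].
by apply: (min_norm_uniq r0 P2l P2mid P2p) => //; rewrite pq.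
Qed.

End Flows.

(** * Cut-off by the functions chi_n *)

(** Lagrange's identity: the double sum of the squares (u_i v_j - u_j v_i)^2 is twice the gap. *)
Lemma sum_cauchy_schwarz (R : realFieldType) (I : Type) (s : seq I) (u v : I -> R) :
  (\sum_(i <- s) u i * v i) ^+ 2 <=
  (\sum_(i <- s) u i ^+ 2) * (\sum_(i <- s) v i ^+ 2).
Proof.
have : 0 <= \sum_(i <- s) \sum_(j <- s) (u i * v j - u j * v i) ^+ 2.
  by apply: sumr_ge0 => i _; apply: sumr_ge0 => j _; exact: sqr_ge0.
have -> : \sum_(i <- s) \sum_(j <- s) (u i * v j - u j * v i) ^+ 2 =
  \sum_(i <- s) \sum_(j <- s) (u i ^+ 2 * v j ^+ 2) +
  \sum_(j <- s) \sum_(i <- s) (u j ^+ 2 * v i ^+ 2) -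
  2 * \sum_(i <- s) \sum_(j <- s) ((u i * v i) * (u j * v j)).
  rewrite [X in _ + X - _]exchange_big/= mulr_sumr -big_split -sumrB/=.
  apply: eq_bigr => i _; rewrite mulr_sumr -big_split -sumrB/=.
  by apply: eq_bigr => j _; ring.
by rewrite -!big_distrlr/= -expr2; lra.
Qed.

Section Cutoff.
Context {R : realType} {K : weighted_graph R}.
Hypothesis lf : locally_finite K.
Local Notation V := (vertex K).
Local Notation E := (edge K).
Local Notation c := (@vweight R K).
Local Notation r := (@eweight R K).
Implicit Types (phi psi : E -> R) (a b : V -> R).

Let c0 := @vweight_gt0 R K.
Let r0 := @eweight_gt0 R K.

(** Each oriented edge has exactly one head, so vertexwise bounds add up to a sum over edges. *)
Lemma psum_in_edges (h : E -> R) : (forall e, 0 <= h e) ->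
  psum (fun x : V => \sum_(e <- fset_set [set e : E | edge_head e = x]) h e) = psum h.
Proof.
move=> h0; pose J (x : V) := [set e : E | edge_head e = x].
transitivity (\esum_(x in [set: V]) \esum_(e in J x) (h e)%:E)%E.
  apply: eq_esum => x _; rewrite esum_fset.
  - by rewrite fsbig_finite ?sumEFin//; exact: finite_in_edges.
  - exact: finite_in_edges.
  - by move=> e _; rewrite lee_fin.
rewrite esum_esum; last by move=> x e _ _; rewrite lee_fin.
rewrite (reindex_esum [set: E] _ (fun e => (edge_head e, e)))//.
split.
- by move=> e _; split.
- by move=> e e' _ _ [].
- by move=> [x e] [_ /= <-]; exists e.
Qed.

(** The mean over both ends is invariant under reversal of e, so multiplying by it preserves
    antisymmetry; the value at the head alone would not. *)
Definition avg (f : V -> R) (e : E) : R := 2^-1 * (f (edge_head e) + f (edge_tail e)).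

(** Discrete Leibniz rule: at an edge with head x, the mean is f x minus half of the coboundary. *)
Lemma inflow_avg (f : V -> R) phi x :
  inflow (fun e => avg f e * phi e) x =
  f x * inflow phi x - 2^-1 *
    \sum_(e <- fset_set [set e : E | edge_head e = x]) r e * phi e * coboundary f e.
Proof.
rewrite !inflowE// !mulr_sumr -sumrB; apply: eq_big_seq => e.
rewrite in_fset_set; last exact: finite_in_edges.
by move=> /set_mem/= <-; rewrite /avg /coboundary; field.
Qed.

(** Cauchy-Schwarz on the edges entering x, with C coming from condition (iii) and 1 / 4 from the
    square of the factor 1 / 2. The indicator on the right is kept because it makes the bound tend
    to zero along the cut-offs. *)
Lemma coboundary_sum_bound (f : V -> R) phi (C : R) x :
  (c x)^-1 * \sum_(e \in [set e : E | edge_head e = x \/ edge_tail e = x])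
     (r e * coboundary f e ^+ 2) <= C ->
  c x * ((c x)^-1 * (2^-1 * \sum_(e <- fset_set [set e : E | edge_head e = x])
     r e * phi e * coboundary f e)) ^+ 2 <=
  C / 4 * \sum_(e <- fset_set [set e : E | edge_head e = x])
     (coboundary f e != 0)%:R * (r e * phi e ^+ 2).
Proof.
set s := fset_set _; set t := [set e : E | _ \/ _] => Ct.
set d := coboundary f.
set A := \sum_(e <- s) (d e != 0)%:R * (r e * phi e ^+ 2).
have A0 : 0 <= A.
  by apply: sumr_ge0 => e _; rewrite mulr_ge0 ?ler0n// mulr_ge0 ?sqr_ge0// ltW.
set S := \sum_(e <- s) _.
have : S ^+ 2 <= A * \sum_(e <- s) r e * d e ^+ 2.
  (* The weight r is shared as a square root between phi and d; inserting the indicator changes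
     nothing, since the terms with d e = 0 vanish anyway. *)
  have := sum_cauchy_schwarz s (fun e => (d e != 0)%:R * (Num.sqrt (r e) * phi e))
    (fun e => Num.sqrt (r e) * d e).
  congr (_ ^+ 2 <= _ * _); apply: eq_bigr => e _;
    rewrite ?exprMn ?sqr_sqrtr ?(ltW (r0 _))//.
  - have [->|de] := eqVneq (d e) 0; first by rewrite !mulr0.
    by rewrite mul1r mulrACA -expr2 sqr_sqrtr ?(ltW (r0 _))// mulrA.
  - by case: eqP => _; rewrite ?expr1n ?expr0n.
(* Condition (iii) counts edges entering and leaving x; the entering ones give a smaller sum. *)
have St : (c x)^-1 * \sum_(e <- s) r e * d e ^+ 2 <= C.
  apply: le_trans Ct; rewrite ler_pM2l ?invr_gt0//.
  have st : [set e : E | edge_head e = x] `<=` t by move=> e; left.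
  have ft : finite_set t by exact: lf.
  rewrite (fsbigID [set e : E | edge_head e = x])//= setIidr//.
  rewrite fsbig_finite; last exact: finite_in_edges.
  rewrite lerDl fsumr_ge0// => e _.
  by rewrite mulr_ge0 ?sqr_ge0// ltW.
move=> Sle; have cx := c0 x.
rewrite [leLHS](_ : _ = (c x)^-1 / 4 * S ^+ 2); last first.
  by field; rewrite gt_eqF.
apply: (@le_trans _ _ ((c x)^-1 / 4 * (A * \sum_(e <- s) r e * d e ^+ 2))).
  by rewrite ler_pM2l// divr_gt0 ?invr_gt0.
rewrite [leLHS](_ : _ = ((c x)^-1 * \sum_(e <- s) r e * d e ^+ 2) * (A / 4)); last first.
  by ring.
rewrite [leRHS](_ : _ = C * (A / 4)); last by ring.
by rewrite ler_wpM2r// divr_ge0.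
Qed.

(** The error phi_n - phi is dominated by phi and vanishes at each edge for large n. The divergence
    error is (chi_n - 1) a, eventually zero as a has finite support, minus the gradient term, whose
    energy is at most C / 4 times that of phi where d chi_n is nonzero. *)
Lemma rflow_approx a phi : chi_complete K -> fin_supp a -> rflow a phi ->
  exists phi_ : nat -> E -> R,
  [/\ forall n, antisymmetric1 (phi_ n), forall n, fin_supp (phi_ n),
     sqn r (phi_ n - phi) @[n --> \oo] --> 0%E &
     sqn c (fun x => (c x)^-1 * (inflow (phi_ n) x - a x)) @[n --> \oo] --> 0%E].
Proof.
move=> [B [chi [[_ Bmono Bcov] [chifin chi01 chiB [C C0 chiC]]]]] afin.
move=> [aphi lphi phia].
have chi1 x : \forall n \near \oo, chi n x = 1.
  have : [set: V] x by [].
  rewrite -Bcov => -[N _ BN]; near=> n; apply: chiB.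
  by apply: Bmono BN; near: n; exact: nbhs_infty_ge.
have d0 e : \forall n \near \oo, coboundary (chi n) e = 0.
  near=> n; rewrite /coboundary.
  have -> : chi n (edge_head e) = 1 by near: n; exact: chi1.
  have -> : chi n (edge_tail e) = 1 by near: n; exact: chi1.
  by rewrite subrr.
exists (fun n e => avg (chi n) e * phi e); split.
- by move=> n e; rewrite aphi mulrN /avg addrC.
- move=> n; apply: (@sub_finite_set _ _ (\bigcup_(x in [set x | chi n x != 0])
      [set e : E | edge_head e = x \/ edge_tail e = x])); last first.
    by apply: bigcup_finite => [|x _]; [exact: chifin|exact: lf].
  move=> e /=; have [h0|h0 _] := eqVneq (chi n (edge_head e)) 0; last first.
    by exists (edge_head e) => //; left.
  have [t0|t0 _] := eqVneq (chi n (edge_tail e)) 0; last first.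
    by exists (edge_tail e) => //; right.
  by rewrite /avg h0 t0 addr0 mulr0 mul0r eqxx.
- apply: (@psum_dominated _ _ _ (fun e => r e * phi e ^+ 2)) => //.
    move=> n e; apply/andP; split; first by rewrite mulr_ge0 ?sqr_ge0 ?ltW.
    rewrite !fctE ler_pM2l//.
    rewrite [leLHS](_ : _ = (avg (chi n) e - 1) ^+ 2 * phi e ^+ 2); last by ring.
    rewrite ler_piMl ?sqr_ge0// /avg.
    have := chi01 n (edge_head e); have := chi01 n (edge_tail e).
    by move: (chi n _) (chi n _) => p q; nra.
  move=> e; near=> n; rewrite !fctE /avg.
  have -> : chi n (edge_head e) = 1 by near: n; exact: chi1.
  have -> : chi n (edge_tail e) = 1 by near: n; exact: chi1.
  by rewrite mulVf// mul1r subrr expr0n mulr0.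
(* Energy density of phi on the edges where chi_n is not constant; it is dominated by that of phi
   and eventually zero at each edge. *)
- pose h n e := (coboundary (chi n) e != 0)%:R * (r e * phi e ^+ 2).
  have h0 n e : 0 <= h n e.
    by rewrite mulr_ge0 ?ler0n// mulr_ge0 ?sqr_ge0// ltW.
  have hc : psum (h n) @[n --> \oo] --> 0%E.
    apply: (@psum_dominated _ _ _ (fun e => r e * phi e ^+ 2)) => //.
      move=> n e; rewrite h0 /h/= ler_piMl//; last by case: (_ != _).
      by rewrite mulr_ge0 ?sqr_ge0 ?ltW.
    move=> e; near=> n; rewrite /h.
    have -> : coboundary (chi n) e = 0 by near: n; exact: d0.
    by rewrite eqxx mul0r.
  have /cvge0P hP : forall n, (0 <= psum (h n))%E by move=> n; exact: psum_ge0.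
  apply/cvge0P; first by move=> n; exact: sqn_ge0.
  move=> e e0; have Ce : 0 < e / (C / 4) by rewrite !divr_gt0.
  have asupp : \forall n \near \oo, forall x, x \in fset_set [set x | a x != 0] ->
      chi n x = 1.
    exact: near_fset.
  near=> n.
  have chia x : (chi n x - 1) * a x = 0.
    have [->|ax] := eqVneq (a x) 0; first by rewrite mulr0.
    suff -> : chi n x = 1 by rewrite subrr mul0r.
    have : x \in fset_set [set x | a x != 0] by rewrite in_fset_set// mem_set.
    by move: (x); near: n.
  apply: (@le_trans _ _ ((C / 4)%:E * psum (h n))%E).
    rewrite -psum_in_edges// -psumZ; last by rewrite divr_ge0// ltW.
    rewrite /sqn; apply: le_psum => x.
    apply: le_trans (coboundary_sum_bound phi (chiC n x)).
    rewrite inflow_avg phia; set S := \sum_(_ <- _) _.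
    rewrite (_ : chi n x * a x - _ - a x = - (2^-1 * S)) ?mulrN ?sqrrN//.
    by have := chia x; lra.
  have : (psum (h n) <= (e / (C / 4))%:E)%E.
    by near: n; exact: (hP.1 hc).
  have C4 : 0 < C / 4 by rewrite divr_gt0.
  rewrite -(@lee_pmul2l _ (C / 4)%:E) ?lte_fin// => /le_trans; apply.
  by rewrite -EFinM lee_fin mulrC divfK// gt_eqF.
Unshelve. all: by end_near. Qed.

End Cutoff.

(** * Complex fields *)

Definition cre (R : realType) (T : Type) (f : T -> R[i]) (t : T) : R := complex.Re (f t).
Definition cim (R : realType) (T : Type) (f : T -> R[i]) (t : T) : R := complex.Im (f t).

Lemma cre_cim_inj (R : realType) (T : Type) (f g : T -> R[i]) :
  cre f = cre g -> cim f = cim g -> f = g.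
Proof.
move=> /funeqP re /funeqP im; apply/funext => t.
have := re t; have := im t; rewrite /cre /cim.
by case: (f t) (g t) => [x y] [x' y'] /= -> ->.
Qed.

Lemma normc_sqr (R : realType) (z : R[i]) :
  Normc.normc z ^+ 2 = complex.Re z ^+ 2 + complex.Im z ^+ 2.
Proof. by case: z => x y /=; rewrite sqr_sqrtr// addr_ge0 ?sqr_ge0. Qed.

Lemma Re_realM (R : realType) (x : R) (z : R[i]) :
  complex.Re (x%:C * z) = x * complex.Re z.
Proof. by case: z => a b /=; rewrite mul0r subr0. Qed.

Lemma Im_realM (R : realType) (x : R) (z : R[i]) :
  complex.Im (x%:C * z) = x * complex.Im z.
Proof. by case: z => a b /=; rewrite mul0r addr0. Qed.

Lemma cvg_sqrte0 (R : realType) (u : nat -> \bar R) : (forall n, (0 <= u n)%E) ->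
  sqrte (u n) @[n --> \oo] --> 0%E <-> u n @[n --> \oo] --> 0%E.
Proof.
move=> u0; have su0 n : (0 <= sqrte (u n))%E by exact: sqrte_ge0.
have le_sqr n (e : R) : 0 < e -> (sqrte (u n) <= e%:E)%E = (u n <= (e ^+ 2)%:E)%E.
  move=> e0; rewrite -[RHS]lee_sqrt ?lee_fin ?sqr_ge0//=.
  by rewrite sqrtr_sqr gtr0_norm.
split=> /cvge0P H; apply/cvge0P => // e e0.
- have s0 : 0 < Num.sqrt e by rewrite sqrtr_gt0.
  near=> n; rewrite -[e in e%:E]sqr_sqrtr ?(ltW e0)// -le_sqr//.
  by near: n; exact: (H su0).
- by near=> n; rewrite le_sqr//; near: n; apply: (H u0); rewrite exprn_gt0.
Unshelve. all: by end_near. Qed.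

Lemma cvg_mule0 (R : realType) (k : R) (u : nat -> \bar R) : 0 < k ->
  (forall n, (0 <= u n)%E) ->
  (k%:E * u n)%E @[n --> \oo] --> 0%E <-> u n @[n --> \oo] --> 0%E.
Proof.
move=> k0 u0.
have ku0 n : (0 <= k%:E * u n)%E by rewrite mule_ge0// lee_fin ltW.
have le_k n (e : R) : (k%:E * u n <= e%:E)%E = (u n <= (k^-1 * e)%:E)%E.
  by rewrite EFinM -lee_pdivlMl.
split=> /cvge0P H; apply/cvge0P => // e e0.
- near=> n; rewrite -[e](mulKf (lt0r_neq0 k0)) -le_k.
  by near: n; apply: (H ku0); rewrite mulr_gt0.
- by near=> n; rewrite le_k; near: n; apply: (H u0); rewrite mulr_gt0// invr_gt0.
Unshelve. all: by end_near. Qed.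

Lemma cvg_adde0 (R : realType) (u v : nat -> \bar R) : (forall n, (0 <= u n)%E) ->
  (forall n, (0 <= v n)%E) ->
  (u n + v n)%E @[n --> \oo] --> 0%E <->
  u n @[n --> \oo] --> 0%E /\ v n @[n --> \oo] --> 0%E.
Proof.
move=> u0 v0; split=> [uv|[hu hv]]; last first.
  by rewrite -(adde0 0%E); apply: cvgeD.
by split; apply: (squeeze_cvge _ (cvg_cst _) uv); near=> n;
  rewrite ?u0 ?v0/= ?leeDl ?leeDr.
Unshelve. all: by end_near. Qed.

Lemma fin_supp_l2 (R : realType) (T : choiceType) (w g : T -> R) :
  (forall t, 0 < w t) -> fin_supp g -> l2 w g.
Proof.
move=> w0 gfin; rewrite /l2 /sqn (psum_fset (F := fset_set [set t | g t != 0])) ?ltry//.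
  by move=> t; exact: wsqr_ge0.
move=> t; rewrite in_fset_set// notin_setE/= => /negP; rewrite negbK => /eqP ->.
by rewrite expr0n mulr0.
Qed.

Section ComplexFields.
Context {R : realType} {K : weighted_graph R}.
Hypothesis lf : locally_finite K.
Local Notation V := (vertex K).
Local Notation E := (edge K).
Local Notation c := (@vweight R K).
Local Notation r := (@eweight R K).
Implicit Types (phi : E -> R[i]) (f : V -> R[i]) (z : E -> int).

Let c0 := @vweight_gt0 R K.
Let r0 := @eweight_gt0 R K.

Lemma norm0E f : norm0 f = sqrte (sqn c (cre f) + sqn c (cim f)).
Proof.
rewrite /norm0 /sqn -psumD; try by move=> t; exact: wsqr_ge0.
by congr sqrte; apply: eq_esum => v _; rewrite normc_sqr mulrDr.
Qed.

Lemma norm1E phi : norm1 phi = sqrte ((2^-1)%:E * (sqn r (cre phi) + sqn r (cim phi))).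
Proof.
rewrite /norm1 /sqn -psumD; try by move=> t; exact: wsqr_ge0.
by congr (sqrte (_ * _)%E); apply: eq_esum => v _; rewrite normc_sqr mulrDr.
Qed.

Lemma sqrte_ltoo (x : \bar R) : (sqrte x < +oo)%E = (x < +oo)%E.
Proof. by case: x => [x| |] //=; rewrite !ltry. Qed.

Lemma sqnD_lt (T : choiceType) (w g h : T -> R) : (forall t, 0 < w t) ->
  (sqn w g + sqn w h < +oo)%E <-> l2 w g /\ l2 w h.
Proof.
move=> w0; have := sqn_ge0 w0 g; have := sqn_ge0 w0 h; rewrite /l2.
by case: (sqn w g) (sqn w h) => [x| |] [y| |] //= _ _; rewrite ?ltry;
  split=> // -[].
Qed.

Lemma antisymmetric1E phi :
  antisymmetric1 phi <-> antisymmetric1 (cre phi) /\ antisymmetric1 (cim phi).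
Proof.
split=> [h|[h1 h2] e].
  by split=> e; rewrite /cre /cim h; case: (phi e).
have := h1 e; have := h2 e; rewrite /cre /cim.
by case: (phi e) (phi (opp_edge e)) => [x y] [x' y'] /= -> ->.
Qed.

Lemma L2E_E phi : L2E phi <-> [/\ antisymmetric1 (cre phi), antisymmetric1 (cim phi),
  l2 r (cre phi) & l2 r (cim phi)].
Proof.
rewrite /L2E antisymmetric1E norm1E sqrte_ltoo.
have -> : ((2^-1)%:E * (sqn r (cre phi) + sqn r (cim phi)) < +oo)%E =
   (sqn r (cre phi) + sqn r (cim phi) < +oo)%E.
  have := adde_ge0 (sqn_ge0 r0 (cre phi)) (sqn_ge0 r0 (cim phi)).
  case: (_ + _)%E => [x| |] //=; first by rewrite -EFinM !ltry.
  by move=> _; rewrite gt0_muley ?lte_fin ?invr_gt0.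
by rewrite sqnD_lt//; split=> [[[? ?] [? ?]]|[? ? ? ?]]; split.
Qed.

Lemma cre_delta phi x : complex.Re (delta phi x) = (c x)^-1 * inflow (cre phi) x.
Proof.
rewrite /delta Re_realM inflowE// fsbig_finite; last exact: finite_in_edges.
rewrite raddf_sum; congr (_ * _); apply: eq_bigr => e _.
exact: Re_realM.
Qed.

Lemma cim_delta phi x : complex.Im (delta phi x) = (c x)^-1 * inflow (cim phi) x.
Proof.
rewrite /delta Im_realM inflowE// fsbig_finite; last exact: finite_in_edges.
rewrite raddf_sum; congr (_ * _); apply: eq_bigr => e _.
exact: Im_realM.
Qed.

Lemma norm1_cvg0 (phi_ : nat -> E -> R[i]) :
  norm1 (phi_ n) @[n --> \oo] --> 0%E <->
  sqn r (cre (phi_ n)) @[n --> \oo] --> 0%E /\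
  sqn r (cim (phi_ n)) @[n --> \oo] --> 0%E.
Proof.
have -> : (fun n => norm1 (phi_ n)) =
    (fun n => sqrte ((2^-1)%:E * (sqn r (cre (phi_ n)) + sqn r (cim (phi_ n)))))%E.
  by apply/funext => n; rewrite norm1E.
have s0 n : (0 <= sqn r (cre (phi_ n)) + sqn r (cim (phi_ n)))%E.
  by rewrite adde_ge0 ?sqn_ge0.
rewrite cvg_sqrte0; last by move=> n; rewrite mule_ge0// lee_fin invr_ge0.
by rewrite cvg_mule0 ?invr_gt0// cvg_adde0// => n; rewrite sqn_ge0.
Qed.

Lemma norm0_cvg0 (f_ : nat -> V -> R[i]) :
  norm0 (f_ n) @[n --> \oo] --> 0%E <->
  sqn c (cre (f_ n)) @[n --> \oo] --> 0%E /\
  sqn c (cim (f_ n)) @[n --> \oo] --> 0%E.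
Proof.
have -> : (fun n => norm0 (f_ n)) =
    (fun n => sqrte (sqn c (cre (f_ n)) + sqn c (cim (f_ n)))).
  by apply/funext => n; rewrite norm0E.
by rewrite cvg_sqrte0 ?cvg_adde0// => n; rewrite ?adde_ge0 ?sqn_ge0.
Qed.

Lemma creB (T : Type) (g h : T -> R[i]) : cre (g \- h) = cre g - cre h.
Proof. by apply/funext => t; rewrite /cre raddfB. Qed.

Lemma cimB (T : Type) (g h : T -> R[i]) : cim (g \- h) = cim g - cim h.
Proof. by apply/funext => t; rewrite /cim raddfB. Qed.

(** Convergence in norm implies convergence at each edge and vertex, and the inflow at x is a finite
    sum; hence the closure still acts by the pointwise formula. *)
Lemma inflow_limit (p_ : nat -> E -> R) (p : E -> R) (g : V -> R) :
  sqn r (p_ n - p) @[n --> \oo] --> 0%E ->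
  sqn c ((fun x => (c x)^-1 * inflow (p_ n) x) - g) @[n --> \oo] --> 0%E ->
  forall x, inflow p x = c x * g x.
Proof.
move=> /(sqn_cvg_pointwise r0) pc /(sqn_cvg_pointwise c0) gc x.
apply: (seq_cvg_unique (cvg_inflow lf pc)).
have -> : (fun n => inflow (p_ n) x) = (fun n => c x * ((c x)^-1 * inflow (p_ n) x)).
  by apply/funext => n; rewrite mulVKf// gt_eqF.
by apply: cvgM; [exact: cvg_cst|exact: gc].
Qed.

Lemma delta_barP phi f : chi_complete K -> fin_supp f ->
  delta_bar phi f <-> rflow (fun x => c x * cre f x) (cre phi) /\
                      rflow (fun x => c x * cim f x) (cim phi).
Proof.
move=> chiK ffin; split.
  move=> [/L2E_E[a1 a2 l1 l2] _ [phi_ [_ /norm1_cvg0[p1 p2] /norm0_cvg0[q1 q2]]]].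
  split; split => //.
  - apply: (inflow_limit (p_ := fun n => cre (phi_ n))).
    + by apply: eq_seq_cvg p1 => n; rewrite creB.
    + apply: eq_seq_cvg q1 => n.
      by congr sqn; apply/funext => x; rewrite creB fctE /cre cre_delta.
  - apply: (inflow_limit (p_ := fun n => cim (phi_ n))).
    + by apply: eq_seq_cvg p2 => n; rewrite cimB.
    + apply: eq_seq_cvg q2 => n.
      by congr sqn; apply/funext => x; rewrite cimB fctE /cim cim_delta.
have fin0 (k : V -> R) (g : V -> R) : (forall x, f x = 0 -> g x = 0) ->
    fin_supp (fun x => k x * g x).
  move=> fg; apply: sub_finite_set ffin => x /=; apply: contra => /eqP/fg ->.
  by rewrite mulr0.
have fin1 k : fin_supp (fun x => k x * cre f x) by apply: fin0 => x; rewrite /cre => ->.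
have fin2 k : fin_supp (fun x => k x * cim f x) by apply: fin0 => x; rewrite /cim => ->.
move=> [f1 f2]; split.
- by apply/L2E_E; case: f1 => ? ? _; case: f2.
- rewrite /L2V norm0E sqrte_ltoo sqnD_lt//; split; apply: fin_supp_l2 => //.
  + by have := fin1 (fun=> 1); under eq_fun do rewrite mul1r.
  + by have := fin2 (fun=> 1); under eq_fun do rewrite mul1r.
have [p_ [pa pf pp pq]] := rflow_approx lf chiK (fin1 _) f1.
have [q_ [qa qf qp qq]] := rflow_approx lf chiK (fin2 _) f2.
(* Real and imaginary parts are approximated separately and recombined at equal index. *)
exists (fun n e => p_ n e +i* q_ n e); split.
- move=> n; split; first by apply/antisymmetric1E; split; [exact: pa|exact: qa].
  apply: (@sub_finite_set _ _
    ([set e | p_ n e != 0] `|` [set e | q_ n e != 0])); last first.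
    by rewrite finite_setU; split; [exact: pf|exact: qf].
  move=> e /=; rewrite eq_complex negb_and => /orP[]; [by left|by right].
- apply/norm1_cvg0; split; [apply: eq_seq_cvg pp|apply: eq_seq_cvg qp] => n;
    by rewrite ?creB ?cimB.
- apply/norm0_cvg0; split; [apply: eq_seq_cvg pq|apply: eq_seq_cvg qq] => n;
    congr sqn; apply/funext => x; rewrite ?creB ?cimB fctE.
  + by rewrite /cre cre_delta mulrBr mulKf// gt_eqF.
  + by rewrite /cim cim_delta mulrBr mulKf// gt_eqF.
Qed.

(** * Cycles as divergence-free fields, and the real form of the problem *)

Definition rchain z (e : E) : R := (z e)%:~R / r e.

Lemma chain_cochainE z e : chain_cochain z e = (@rchain z e)%:C :> R[i].
Proof. by rewrite /chain_cochain /rchain rmorphM rmorph_int fmorphV. Qed.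

(** The weight in [inflow] cancels the 1 / r of E_Z, so the inflow at x is the boundary coefficient
    of z at x. *)
Lemma L2_cycle_flow z : L2_cycle z -> rflow (0 : V -> R) (rchain z).
Proof.
move=> [[za zb] /L2E_E[_ _ l1 _]]; split.
- by move=> e; rewrite /rchain za eweight_opp mulrNz mulNr.
- by move: l1; congr l2; apply/funext => e; rewrite /cre chain_cochainE.
- move=> x; rewrite inflowE//.
  transitivity ((boundary z x)%:~R : R); last by rewrite zb.
  rewrite /boundary fsbig_finite; last exact: finite_in_edges.
  rewrite rmorph_sum; apply: eq_bigr => e _.
  by rewrite /rchain mulrC divfK// gt_eqF.
Qed.

(** The same cancellation of r turns the circulation into an inner product; as E_Z is real, it tests
    both parts of phi independently. *)
Lemma chain_integralE z phi : chain_integral z phi =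
  2^-1 * (dot r (cre phi) (rchain z) +i* dot r (cim phi) (rchain z)).
Proof.
rewrite /chain_integral /csum /dot; congr (_ * (_ +i* _)); congr rsum;
  apply/funext => e; rewrite -[(z e)%:~R](rmorph_int (real_complex R)).
- by rewrite Re_realM /rchain /cre; field; rewrite gt_eqF.
- by rewrite Im_realM /rchain /cim; field; rewrite gt_eqF.
Qed.

Lemma solutionP (i : V -> R[i]) (F I : E -> R[i]) : chi_complete K -> fin_supp i ->
  solution i F I <->
  (rflow (fun x => - (c x * cre i x)) (cre I) /\
     forall q, (rchain @` @L2_cycle R K) q -> dot r (cre I) q = dot r (cre F) q) /\
  (rflow (fun x => - (c x * cim i x)) (cim I) /\
     forall q, (rchain @` @L2_cycle R K) q -> dot r (cim I) q = dot r (cim F) q).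
Proof.
move=> chiK ifin.
have nifin : fin_supp (fun x => - i x).
  by apply: sub_finite_set ifin => x /=; rewrite oppr_eq0.
have eqre : (fun x => c x * cre (fun x => - i x) x) = (fun x => - (c x * cre i x)).
  by apply/funext => x; rewrite /cre raddfN mulrN.
have eqim : (fun x => c x * cim (fun x => - i x) x) = (fun x => - (c x * cim i x)).
  by apply/funext => x; rewrite /cim raddfN mulrN.
(* The value f is forced to be - i, which has finite support, so [delta_barP] applies to it. *)
have -> : solution i F I <-> delta_bar I (fun x => - i x) /\
    forall z, L2_cycle z -> chain_integral z F = chain_integral z I.
  split=> [[[f df fi] zI]|[dI zI]]; split=> //.
    suff -> : (fun x => - i x) = f by [].
    by apply/funext => x; apply/eqP; rewrite eq_sym -addr_eq0; apply/eqP.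
  by exists (fun x => - i x) => // v; rewrite addNr.
rewrite delta_barP// eqre eqim.
split=> [[[f1 f2] zI]|[[f1 z1] [f2 z2]]].
  have zE z : L2_cycle z ->
      dot r (cre I) (rchain z) = dot r (cre F) (rchain z) /\
      dot r (cim I) (rchain z) = dot r (cim F) (rchain z).
    have two0 : (2^-1 : R[i]) != 0 by rewrite invr_eq0 pnatr_eq0.
    by move=> /zI; rewrite !chain_integralE => /(mulfI two0)[-> ->].
  by split; split=> // _ [z /zE[h1 h2] <-].
split=> // z zL; rewrite !chain_integralE z1 ?z2//; by exists z.
Qed.

Lemma norm1_le (I J : E -> R[i]) : L2E I -> L2E J ->
  (norm1 I <= norm1 J)%E = (dot r (cre I) (cre I) + dot r (cim I) (cim I) <=
    dot r (cre J) (cre J) + dot r (cim J) (cim J)).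
Proof.
move=> /L2E_E[_ _ I1 I2] /L2E_E[_ _ J1 J2].
rewrite !norm1E lee_sqrt; last by rewrite mule_ge0 ?lee_fin ?invr_ge0 ?adde_ge0 ?sqn_ge0.
by rewrite lee_pmul2l// -!dotxx.
Qed.
End ComplexFields.

Theorem theorem2 (R : realType) (K : weighted_graph R)
  (K_connected : connected_graph K)
  (K_locally_finite : locally_finite K)
  (K_chi_complete : chi_complete K)
  (i : vertex K -> R[i]) (i_fin : fin_supp i)
  (i_sum0 : \sum_(v \in [set: vertex K]) ((vweight v)%:C * i v) = 0)
  (E' : edge K -> R[i]) (E'_L2 : L2E E') :
  exists! I : edge K -> R[i], minimal_energy_solution i E' I.
Proof.
have ci0 v : v \notin fset_set [set v | i v != 0] -> i v = 0.
  by rewrite in_fset_set// notin_setE/= => /negP; rewrite negbK => /eqP.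
have ciE : \sum_(v <- fset_set [set v | i v != 0]) ((vweight v)%:C * i v) = 0.
  by rewrite -fsbigTE// => v /ci0 ->; rewrite mulr0.
(* Stated for any real g vanishing where i does, to be used for both the real and the imaginary part
   of i. *)
have flow_ex (g : vertex K -> R) : (forall v, i v = 0 -> g v = 0) ->
    \sum_(v <- fset_set [set v | i v != 0]) vweight v * g v = 0 ->
    @rflow R K (fun v => - (vweight v * g v)) !=set0.
  move=> ig sg; apply: rflow_ex => //.
    apply: sub_finite_set i_fin => v /=; apply: contra => /eqP/ig ->.
    by rewrite mulr0 oppr0.
  rewrite (fsbigTE (fset_set [set v | i v != 0])).
    by rewrite sumrN sg oppr0.
  by move=> v /ci0/ig ->; rewrite mulr0 oppr0.
have re_ex : @rflow R K (fun v => - (vweight v * cre i v)) !=set0.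
  apply: flow_ex; first by move=> v; rewrite /cre => ->.
  have := congr1 (@complex.Re R) ciE; rewrite raddf_sum/= => sum0.
  by rewrite -[RHS]sum0; apply: eq_bigr => v _; rewrite -Re_realM.
have im_ex : @rflow R K (fun v => - (vweight v * cim i v)) !=set0.
  apply: flow_ex; first by move=> v; rewrite /cim => ->.
  have := congr1 (@complex.Im R) ciE; rewrite raddf_sum/= => sum0.
  by rewrite -[RHS]sum0; apply: eq_bigr => v _; rewrite -Im_realM.
have cycles : rchain @` @L2_cycle R K `<=` rflow (0 : vertex K -> R).
  by move=> _ [z zL <-]; exact: L2_cycle_flow.
have /L2E_E[a1 a2 l1 l2] := E'_L2.
have [p [fp zp] pmin] := min_energy_ex K_locally_finite re_ex a1 l1 cycles.
have [q [fq zq] qmin] := min_energy_ex K_locally_finite im_ex a2 l2 cycles.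
pose I e := p e +i* q e.
have solP := solutionP K_locally_finite E' _ K_chi_complete i_fin.
have Isol : solution i E' I by apply/solP.
have sol_L2 J : solution i E' J -> L2E J by move=> [[f []]].
have sol_min J : solution i E' J ->
    (dot (@eweight R K) p p <= dot (@eweight R K) (cre J) (cre J) ?= iff (cre J == p)) /\
    (dot (@eweight R K) q q <= dot (@eweight R K) (cim J) (cim J) ?= iff (cim J == q)).
  by move=> /solP[[J1 J2] [J3 J4]]; split; [exact: pmin|exact: qmin].
exists I; split.
  split=> // J solJ; rewrite norm1_le; [|exact: sol_L2..].
  by have [h1 h2] := sol_min J solJ; rewrite lerD ?h1 ?h2.
move=> J [solJ /(_ I Isol)]; rewrite norm1_le; [|exact: sol_L2..].
have [h1 h2] := sol_min J solJ => JI.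
have eqN : dot (@eweight R K) p p + dot (@eweight R K) q q =
    dot (@eweight R K) (cre J) (cre J) + dot (@eweight R K) (cim J) (cim J).
  by apply: le_anti; rewrite JI lerD ?h1 ?h2.
(* Equality of the two sums forces equality in each part, and the equality cases identify the parts
   of J with p and q. *)
have := leifD h1 h2; rewrite /Order.leif eqN eqxx => -[_ /esym/andP[/eqP hp /eqP hq]].
by apply: cre_cim_inj; rewrite ?hp ?hq.
Qed.
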